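(* For any set $\mathcal{I}\subseteq B$ of pairwise incompatible pairs, there exists an optimal solution $u^*$ of $(\tilde{D}_{\mathcal{I}})$ that is also optimal for $(D)$ and such that all reduced costs of the pairs of $\mathcal{I}$ are exact: $r_{ij}(u^* )=R_{ij}$ for all $ij\in\mathcal{I}$.
   Context: Setting. $X_1,\dots,X_n$ are variables with finite domains $D(X_i)\subset\mathbb{Z}$, and $C$ is a constraint on them, i.e. a set of allowed tuples. A support for $C$ is an allowed tuple $\langle a_1,\dots,a_n\rangle$ with $a_i\in D(X_i)$ for all $i$. $B=\{ij : 1\le i\le n,\ j\in D(X_i)\}$ is the (finite) set of variable/value pairs, where $ij$ is short for $(i,j)$. The characteristic vector of a support is $x\in\{0,1\}^{B}$ with $x_{ij}=1$ iff $a_i=j$; $\mathcal{S}$ is the set of characteristic vectors of the supports of $C$. Each pair has a cost $c_{ij}\in\mathbb{Z}$. Ideal formulation (standing assumption): $A$ is a real $m\times|B|$ matrix (with columns $A_{ij}$, $ij\in B$) and $b\in\mathbb{R}^m$ are such that $\{x\in\mathbb{R}^{B}_+ : Ax\ge b\}=\mathrm{conv}(\mathcal{S})$. $(P)$: $z^*=\min\{cx : Ax\ge b,\ x\in\mathbb{R}^B_+\}$; $(D)$: $\max\{ub : uA\le c,\ u\in\mathbb{R}^m_+\}$. For $kl\in B$, $(P_{|kl})$ is $(P)$ with the additional constraint $x_{kl}=1$, with optimal value $z^*_{|kl}$. Feasibility (standing assumption): every pair of $B$ belongs to at least one support of $C$; hence $(P)$, $(D)$ and all $(P_{|kl})$ are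 feasible and bounded. For feasible $u$ of $(D)$ the reduced cost of $kl$ (with respect to the original costs $c$) is $r_{kl}(u)=c_{kl}-uA_{kl}$. $R_{kl}=z^*_{|kl}-z^*$. Two distinct pairs $ij,kl\in B$ are incompatible if there is no support for $C$ with $X_i=j$ and $X_k=l$. Modified problem: for a set $\mathcal{I}$ of pairwise incompatible pairs, put $\tilde{c}_{ij}=c_{ij}-R_{ij}$ for $ij\in\mathcal{I}$ and $\tilde{c}_{ij}=c_{ij}$ for $ij\in B\setminus\mathcal{I}$. Then $(\tilde{P}_{\mathcal{I}})$ is $\min\{\tilde{c}x : Ax\ge b,\ x\in\mathbb{R}^B_+\}$ and $(\tilde{D}_{\mathcal{I}})$ is its dual $\max\{ub : uA\le\tilde{c},\ u\in\mathbb{R}^m_+\}$. *)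

(* Defs.v *)
From HB Require Import structures.
From mathcomp Require Import all_boot all_order all_algebra finmap.
From mathcomp Require Import all_classical all_reals all_analysis.

Set Implicit Arguments.
Unset Strict Implicit.
Unset Printing Implicit Defensive.

Import Order.TTheory GRing.Theory Num.Theory.

Local Open Scope classical_set_scope.
Local Open Scope ring_scope.

Section Constraint.
Variables (n : nat) (D : 'I_n -> {fset int}) (C : set (n.-tuple int)).

(* The set B of variable/value pairs. *)
Definition vpair : finType := {i : 'I_n & D i}.

Definition pvar (p : vpair) : 'I_n := tag p.
Definition pval (p : vpair) : int := val (tagged p).

Definition csupport : set (n.-tuple int) :=
  [set a | C a /\ forall i, tnth a i \in D i].

Definition uses (a : n.-tuple int) (p : vpair) : bool :=
  tnth a (pvar p) == pval p.

Definition incompatible (p q : vpair) : Prop :=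
  p != q /\ ~ exists a, [/\ csupport a, uses a p & uses a q].

(* The existence of a support follows from the second clause, except when B is
   empty; it makes the LP relaxation feasible in that case too. *)
Definition feasibility : Prop :=
  (exists a, csupport a) /\ forall p, exists2 a, csupport a & uses a p.

(* Families indexed by B are vectors indexed by 'I_#|B| through [enum_val],
   so that the coordinate of pair [p] is the one of index [enum_rank p]. *)
Definition charvec (R : realType) (a : n.-tuple int) : 'cV[R]_#|vpair| :=
  \col_k (uses a (enum_val k))%:R.

Definition charvecs (R : realType) : set 'cV[R]_#|vpair| :=
  [set charvec R a | a in csupport].

Definition rowB (R : realType) (c : vpair -> R) : 'rV[R]_#|vpair| :=
  \row_k c (enum_val k).

End Constraint.

Arguments csupport {n} D C.
Arguments feasibility {n} D C.
Arguments charvecs {n} D C R.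

Definition convex_hull (R : realType) (E : lmodType R) (S : set E) : set E :=
  smallest (@convex_set R E) S.

Section LinearProgram.
Variables (R : realType) (m N : nat).
Variables (A : 'M[R]_(m, N)) (b : 'cV[R]_m) (c : 'rV[R]_N).

Definition primal_feasible : set 'cV[R]_N :=
  [set x : 'cV[R]_N | (forall k, 0 <= x k 0) /\
                      forall i, b i 0 <= (A *m x) i 0].

Definition dual_feasible : set 'rV[R]_m :=
  [set u : 'rV[R]_m | (forall i, 0 <= u 0 i) /\
                      forall k, (u *m A) 0 k <= c 0 k].

Definition dual_optimal : set 'rV[R]_m :=
  [set u : 'rV[R]_m | dual_feasible u /\
           forall v, dual_feasible v -> (v *m b) 0 0 <= (u *m b) 0 0].

(* The infimum of the objective over the feasible set [F]; it is the minimum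
   as soon as the latter exists. *)
Definition min_value (F : set 'cV[R]_N) : R :=
  inf [set (c *m x) 0 0 | x in F].

End LinearProgram.

Section ReducedCosts.
Variables (n : nat) (D : 'I_n -> {fset int}) (R : realType) (m : nat).
Variables (A : 'M[R]_(m, #|vpair D|)) (b : 'cV[R]_m).

Definition costR (c : vpair D -> int) (p : vpair D) : R := (c p)%:~R.

Definition zstar (c : vpair D -> int) : R :=
  min_value (rowB (costR c)) (primal_feasible A b).

Definition zstar_at (c : vpair D -> int) (p : vpair D) : R :=
  min_value (rowB (costR c))
    (primal_feasible A b `&` [set x : 'cV[R]_#|vpair D| | x (enum_rank p) 0 = 1]).

Definition Rgap (c : vpair D -> int) (p : vpair D) : R :=
  zstar_at c p - zstar c.

Definition reduced_cost (c : vpair D -> int) (p : vpair D) (u : 'rV[R]_m) : R :=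
  costR c p - (u *m col (enum_rank p) A) 0 0.

Definition modified_cost (c : vpair D -> int) (I : {set vpair D})
    (p : vpair D) : R :=
  if p \in I then costR c p - Rgap c p else costR c p.

End ReducedCosts.

Arguments costR {n D} R c p.

(* Main.v *)
Require Import Defs.
From HB Require Import structures.
From mathcomp Require Import all_boot all_order all_algebra finmap.
From mathcomp Require Import all_classical all_reals all_analysis.
From mathcomp Require Import lra.

Set Implicit Arguments.
Unset Strict Implicit.
Unset Printing Implicit Defensive.

Import Order.TTheory GRing.Theory Num.Theory.

Local Open Scope classical_set_scope.
Local Open Scope ring_scope.

(** Let c~ be the modified cost. By pairwise incompatibility a support uses at
    most one pair of I, so its c~-cost is its c-cost minus at most one gap R_p,
    and both cases give at least z*. Hence c~ x >= z* is valid on conv(S), and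
    Farkas' lemma yields u >= 0 with u A <= c~ and u b >= z*. Since R_p >= 0
    gives c~ <= c, this u is optimal for both duals, and u A <= c~ reads
    r_p(u) >= R_p for p in I. Conversely, for a feasible x with x_p = 1,
    nonnegativity of the reduced costs gives r_p(u) <= c x - u A x <= c x - z*,
    so r_p(u) <= R_p. *)

(** * Farkas' lemma, homogeneous and affine *)

Section Farkas.
Variable R : realType.

(* Bartl's argument: if the first inequality [a] is not redundant, a witness
   [x0] normalised by [a x0 = 1] lets one project along [x0] onto the kernel of
   [a], which eliminates [a]. *)
Lemma farkas n m (A : 'M[R]_(m, n)) (c : 'rV[R]_n) :
  (forall x : 'cV[R]_n, (forall i, 0 <= (A *m x) i 0) -> 0 <= (c *m x) 0 0) ->
  exists2 u : 'rV[R]_m, (forall i, 0 <= u 0 i) & c = u *m A.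
Proof.
elim: m A c => [|m IH].
  move=> A c h; exists 0; first by case.
  rewrite mul0mx; apply/rowP => k; rewrite mxE.
  (* With no inequality every [y] qualifies, so [c] is nonnegative on both [delta_mx k 0] and its
     opposite. *)
  have nonneg (y : 'cV[R]_n) : 0 <= (c *m y) 0 0 by apply: h => -[].
  have ck : (c *m delta_mx k (0 : 'I_1)) 0 0 = c 0 k by rewrite -colE mxE.
  apply/eqP; rewrite eq_le -{2}ck nonneg andbT -oppr_ge0 -ck.
  by have := nonneg (- delta_mx k 0); rewrite mulmxN [X in _ <= X]mxE.
rewrite -[m.+1]/(1 + m)%N => A c.
rewrite -[A]vsubmxK; move: (usubmx A) (dsubmx A) => a {}A h.
have [|] := pselect (forall x : 'cV[R]_n,
  (forall i, 0 <= (A *m x) i 0) -> 0 <= (c *m x) 0 0).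
  move=> /IH[u u0 ->]; exists (row_mx 0 u).
    by move=> i; case: (split_ordP i) => j ->; rewrite ?row_mxEl ?row_mxEr ?mxE.
  by rewrite mul_row_col mul0mx add0r.
move=> /existsNP[x /not_implyP[Ax /negP]]; rewrite -ltNge => cx.
have h1 (y : 'cV[R]_n) : 0 <= (a *m y) 0 0 ->
    (forall i, 0 <= (A *m y) i 0) -> 0 <= (c *m y) 0 0.
  move=> ay Ay; apply: h => i; rewrite mul_col_mx.
  by case: (split_ordP i) => j ->; rewrite ?col_mxEu ?col_mxEd // ord1.
have ax : (a *m x) 0 0 < 0.
  by rewrite ltNge; apply/negP => ax; move: (h1 x ax Ax); rewrite leNgt cx.
pose t := - (a *m x) 0 0; have t0 : 0 < t by rewrite oppr_gt0.
pose x0 := (- t^-1) *: x.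
have ax0 : a *m x0 = 1%:M.
  rewrite -scalemxAr [a *m x]mx11_scalar scale_scalar_mx.
  by rewrite /t invrN opprK mulVf ?lt_eqF.
have Ax0 i : (A *m x0) i 0 <= 0.
  by rewrite -scalemxAr mxE mulNr oppr_le0 mulr_ge0 // invr_ge0 ltW.
have cx0 : 0 < (c *m x0) 0 0.
  by rewrite -scalemxAr mxE mulNr oppr_gt0 pmulr_rlt0 // invr_gt0.
have [y|u u0 cu] := IH (A - A *m x0 *m a) (c - c *m x0 *m a).
  have mulE k (M : 'M[R]_(k, n)) :
      (M - M *m x0 *m a) *m y = M *m (y - x0 *m (a *m y)).
    by rewrite mulmxBl mulmxBr !mulmxA.
  rewrite !mulE; apply: h1.
  by rewrite mulmxBr mulmxA ax0 mul1mx subrr mxE.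
(* Solving [cu] for [c] forces this multiplier of [a]; it is nonnegative because [c *m x0 > 0] while
   [A *m x0 <= 0]. *)
exists (row_mx (c *m x0 - u *m A *m x0) u).
  move=> i; case: (split_ordP i) => j ->; rewrite ?row_mxEl ?row_mxEr // ord1.
  rewrite mxE [X in _ + X]mxE -mulmxA [X in _ - X]mxE subr_ge0.
  apply: le_trans (ltW cx0); apply: sumr_le0 => k _.
  by rewrite mulr_ge0_le0.
rewrite mul_row_col mulmxBl -{1}(subrK (c *m x0 *m a) c) cu mulmxBr !mulmxA.
by rewrite [RHS]addrC [RHS]addrA addrAC.
Qed.

(** The ray [x0 + s *: d] stays feasible, and a negative slope along it would drive the objective
    below [z]. *)
Lemma mulmx_ge_recession n m (A : 'M[R]_(m, n)) (c : 'rV[R]_n) (b : 'cV[R]_m)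
    z (x0 d : 'cV[R]_n) :
  (forall x, primal_feasible A b x -> z <= (c *m x) 0 0) ->
  primal_feasible A b x0 ->
  (forall k, 0 <= d k 0) -> (forall i, 0 <= (A *m d) i 0) ->
  0 <= (c *m d) 0 0.
Proof.
move=> hz [x00 Ax0] d0 Ad; rewrite leNgt; apply/negP => cd.
have ray s : 0 <= s -> z <= (c *m x0) 0 0 + s * (c *m d) 0 0.
  move=> s0; have := hz (x0 + s *: d); rewrite mulmxDr -scalemxAr.
  rewrite [X in _ <= X]mxE [X in _ <= _ + X]mxE; apply; split => k.
    by rewrite mxE [X in _ + X]mxE addr_ge0 // mulr_ge0.
  rewrite mulmxDr -scalemxAr mxE [X in _ + X]mxE.
  by rewrite (le_trans (Ax0 k)) // lerDl mulr_ge0.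
have zx0 := hz _ (conj x00 Ax0).
(* At this value of [s] the objective equals [z - 1]. *)
suff /ray : 0 <= - (((c *m x0) 0 0 - z + 1) / (c *m d) 0 0).
  by rewrite mulNr divfK ?lt_eqF //; lra.
by rewrite oppr_ge0 mulr_ge0_le0 ?invr_le0 ?(ltW cd) //; lra.
Qed.

(** Homogenisation: [farkas] is applied to the cone [A x >= t b], [x >= 0], [t >= 0] and the form
    [c x - z t]. *)
Lemma affine_farkas n m (A : 'M[R]_(m, n)) (b : 'cV[R]_m) (c : 'rV[R]_n) z :
  primal_feasible A b !=set0 ->
  (forall x, primal_feasible A b x -> z <= (c *m x) 0 0) ->
  exists2 u, dual_feasible A c u & z <= (u *m b) 0 0.
Proof.
move=> [x0 fx0] hz.
have [y Ay|u u0 /esym] := @farkas (n + 1) (m + (n + 1))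
    (col_mx (row_mx A (- b)) 1%:M) (row_mx c (- z%:M)).
  move: Ay; rewrite -[y]vsubmxK; move: (usubmx y) (dsubmx y) => x t.
  rewrite mul_col_mx mul1mx !mul_row_col => Ay.
  have xge k : 0 <= x k 0.
    by have := Ay (rshift m (lshift 1 k)); rewrite col_mxEd col_mxEu.
  have tge : 0 <= t 0 0.
    by have := Ay (rshift m (rshift n 0)); rewrite !col_mxEd.
  have tE k (M : 'cV[R]_k) : M *m t = t 0 0 *: M.
    by rewrite {1}[t]mx11_scalar mul_mx_scalar.
  have Axt i : t 0 0 * b i 0 <= (A *m x) i 0.
    have := Ay (lshift _ i); rewrite col_mxEu mulNmx tE mxE [X in _ + X]mxE.
    by rewrite [X in - X]mxE subr_ge0.
  rewrite mulNmx tE mxE [X in _ + X]mxE [X in - X]mxE [z%:M _ _]mxE eqxx subr_ge0.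
  (* The slice [t = 0] consists of recession directions; for [t > 0], dividing by [t] gives a
     feasible point. *)
  have [t0|t0] := eqVneq (t 0 0) 0.
    rewrite t0 mul0r; apply: (mulmx_ge_recession hz fx0) => // i.
    by have := Axt i; rewrite t0 mul0r.
  have tgt : 0 < t 0 0 by rewrite lt_neqAle eq_sym t0.
  have := hz ((t 0 0)^-1 *: x); rewrite -scalemxAr [X in _ <= X]mxE.
  rewrite mulrC ler_pdivlMr // mulrC; apply; split => k.
    by rewrite mxE mulr_ge0 ?invr_ge0.
  by rewrite -scalemxAr [X in _ <= X]mxE mulrC ler_pdivlMr // mulrC.
(* The multipliers of [x >= 0] and [t >= 0] are the slacks in [u A <= c] and [z <= u b]. *)
rewrite -[u]hsubmxK mul_row_col mulmx1 mul_mx_row -[rsubmx u]hsubmxK.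
rewrite add_row_mx => /eq_row_mx[cE zE].
exists (lsubmx u).
  split=> [i|k]; first by rewrite mxE.
  by rewrite -cE [X in _ <= X]mxE lerDl !mxE.
move/matrixP/(_ 0 0): zE; rewrite mulmxN mxE [X in X + _]mxE [RHS]mxE.
rewrite [in RHS]mxE eqxx mulr1n.
have w0 : 0 <= rsubmx (rsubmx u) 0 0 by rewrite !mxE.
by move: w0; lra.
Qed.

End Farkas.

(** * Convex hulls, minimal values and weak duality *)

Lemma convex_hull_ge (R : realType) N (S : set 'cV[R]_N) (f : 'rV[R]_N) M :
  (forall x, S x -> M <= (f *m x) 0 0) ->
  forall x, convex_hull S x -> M <= (f *m x) 0 0.
Proof.
(* A closed half-space containing [S] is convex, hence contains the hull. *)
move=> hS; apply: (@smallest_sub _ _ _ [set x | M <= (f *m x) 0 0]) => // x y t.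
rewrite !inE /= => hx hy; rewrite /conv /= mulmxDr -!scalemxAr !mxE.
move: hx hy; rewrite !mxE => hx hy.
have t0 : 0 <= t%:num by [].
have t1 : t%:num <= 1 by [].
rewrite /unstable.onem; nra.
Qed.

Section MinValue.
Variables (R : realType) (N : nat) (c : 'rV[R]_N) (F : set 'cV[R]_N).

(** The value of [M] is irrelevant: it only keeps [inf] from taking its default value. *)
Lemma min_value_le M : (forall x, F x -> M <= (c *m x) 0 0) ->
  forall x, F x -> min_value c F <= (c *m x) 0 0.
Proof.
move=> hM x Fx; apply: ge_inf; last by exists x.
by exists M => _ [y Fy <-]; apply: hM.
Qed.

Lemma le_min_value z : F !=set0 -> (forall x, F x -> z <= (c *m x) 0 0) ->
  z <= min_value c F.
Proof.
move=> [x Fx] hz; apply: lb_le_inf; first by exists ((c *m x) 0 0), x.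
by move=> _ [y Fy <-]; apply: hz.
Qed.

End MinValue.

(** The middle term is kept because bounding a reduced cost from above uses the first inequality
    alone. *)
Lemma weak_duality (R : realType) m N (A : 'M[R]_(m, N)) b c u x :
  primal_feasible A b x -> dual_feasible A c u ->
  (u *m b) 0 0 <= (u *m A *m x) 0 0 <= (c *m x) 0 0.
Proof.
move=> [x0 Ax] [u0 uA]; rewrite -mulmxA !mxE; apply/andP; split.
  by apply: ler_sum => i _; rewrite ler_wpM2l.
rewrite -[X in X <= _](_ : (u *m A *m x) 0 0 = _); last by rewrite -mulmxA mxE.
by rewrite mxE; apply: ler_sum => k _; rewrite ler_wpM2r.
Qed.

(** * Costs of supports, gaps and reduced costs *)

Section Supports.
Variables (R : realType) (n : nat) (D : 'I_n -> {fset int}).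
Variable C : set (n.-tuple int).
Implicit Types (a : n.-tuple int) (p : vpair D) (d : vpair D -> R).

Lemma rowB_charvecE d a :
  (rowB d *m charvec D R a) 0 0 = \sum_p d p * (uses a p)%:R.
Proof.
rewrite mxE (reindex (@enum_val _ (vpair D))) /=.
  by apply: eq_bigr => k _; rewrite !mxE.
exact/onW_bij/enum_val_bij.
Qed.

Lemma charvec_enum_rank a p : charvec D R a (enum_rank p) 0 = (uses a p)%:R.
Proof. by rewrite mxE enum_rankK. Qed.

(** A crude bound, uniform in [a], which makes the infima defining [zstar] and [zstar_at]
    genuine. *)
Lemma rowB_charvec_ge d a :
  - \sum_p `|d p| <= (rowB d *m charvec D R a) 0 0.
Proof.
rewrite rowB_charvecE -sumrN; apply: ler_sum => p _.
by case: (uses a p); rewrite ?mulr1 ?mulr0 ?oppr_le0 // lerNl -normrN ler_norm.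
Qed.

Variables (m : nat) (A : 'M[R]_(m, #|vpair D|)) (b : 'cV[R]_m).
Variable c : vpair D -> int.
Hypothesis ideal : primal_feasible A b = convex_hull (charvecs D C R).
Hypothesis feas : feasibility D C.

Let cost := rowB (costR R c).

Lemma charvec_feasible a :
  csupport D C a -> primal_feasible A b (charvec D R a).
Proof. by move=> Ca; rewrite ideal; apply: sub_gen_smallest; exists a. Qed.

Lemma cost_bounded x : primal_feasible A b x ->
  - \sum_p `|costR R c p| <= (cost *m x) 0 0.
Proof.
rewrite ideal; apply: convex_hull_ge => _ [a Ca <-]; exact: rowB_charvec_ge.
Qed.

Lemma zstar_le x : primal_feasible A b x -> zstar A b c <= (cost *m x) 0 0.
Proof. exact/min_value_le/cost_bounded. Qed.

Lemma zstar_at_le p x : primal_feasible A b x -> x (enum_rank p) 0 = 1 ->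
  zstar_at A b c p <= (cost *m x) 0 0.
Proof.
move=> fx xp; apply: min_value_le (conj fx xp) => y [fy _].
exact: cost_bounded fy.
Qed.

Lemma le_zstar z : (forall x, primal_feasible A b x -> z <= (cost *m x) 0 0) ->
  z <= zstar A b c.
Proof.
apply: le_min_value; have [[a Ca] _] := feas.
by exists (charvec D R a); apply: charvec_feasible.
Qed.

Lemma le_zstar_at p z :
  (forall x, primal_feasible A b x -> x (enum_rank p) 0 = 1 ->
     z <= (cost *m x) 0 0) ->
  z <= zstar_at A b c p.
Proof.
move=> hz; apply: le_min_value => [|x [fx xp]]; last exact: hz.
have [_ /(_ p)[a Ca ap]] := feas; exists (charvec D R a); split.
  exact: charvec_feasible.
by rewrite /= charvec_enum_rank ap.
Qed.

(** Fixing a coordinate only shrinks the feasible set. *)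
Lemma Rgap_ge0 p : 0 <= Rgap A b c p.
Proof. by rewrite subr_ge0; apply: le_zstar_at => x fx _; apply: zstar_le. Qed.

Lemma modified_cost_le I p : modified_cost A b c I p <= costR R c p.
Proof.
by rewrite /modified_cost; case: ifP => // _; rewrite lerBlDr lerDl Rgap_ge0.
Qed.

Lemma modified_cost_charvec_ge (I : {set vpair D}) a :
  (forall p q, p \in I -> q \in I -> p != q -> incompatible C p q) ->
  csupport D C a ->
  zstar A b c <= (rowB (modified_cost A b c I) *m charvec D R a) 0 0.
Proof.
move=> incompI Ca; have fa := charvec_feasible Ca; rewrite rowB_charvecE.
have [/existsP[p /andP[pI ap]]|] :=
    boolP [exists p, (p \in I) && uses a p]; last first.
  rewrite negb_exists => /forallP noI.
  have := zstar_le fa; rewrite rowB_charvecE; congr (_ <= _).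
  apply: eq_bigr => q _; rewrite /modified_cost; case: ifP => // qI.
  by have := noI q; rewrite qI /= => /negbTE->; rewrite !mulr0.
(* A second pair of [I] used by [a] would be compatible with [p], as [a] itself shows; so [p] alone
   has its cost lowered. *)
have -> : \sum_q modified_cost A b c I q * (uses a q)%:R =
    \sum_q costR R c q * (uses a q)%:R - Rgap A b c p.
  rewrite (bigD1 p) //= [in RHS](bigD1 p) //= ap !mulr1 addrAC.
  rewrite /modified_cost pI; congr (_ + _); apply: eq_bigr => q qp.
  case: ifP => // qI; case aq: (uses a q); rewrite ?mulr0 //.
  by have [_] := incompI _ _ qI pI qp; case; exists a.
have := zstar_at_le (p := p) fa; rewrite charvec_enum_rank ap => /(_ erefl).
by rewrite rowB_charvecE /Rgap; lra.
Qed.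

Lemma reduced_costE p (u : 'rV[R]_m) :
  reduced_cost A c p u = (cost - u *m A) 0 (enum_rank p).
Proof.
rewrite /reduced_cost !mxE enum_rankK; congr (_ - _).
by apply: eq_bigr => i _; rewrite !mxE.
Qed.

Lemma reduced_cost_le_Rgap p (u : 'rV[R]_m) :
  dual_feasible A cost u -> zstar A b c <= (u *m b) 0 0 ->
  reduced_cost A c p u <= Rgap A b c p.
Proof.
move=> fu zu; rewrite lerBrDr; apply: le_zstar_at => x fx xp.
have /andP[ubx _] := weak_duality fx fu; have [x0 _] := fx; have [_ uA] := fu.
(* Since [x] is 1 at [p], the left side is one term of a sum of nonnegative terms. *)
have : reduced_cost A c p u <= ((cost - u *m A) *m x) 0 0.
  rewrite mxE (bigD1 (enum_rank p)) //= xp mulr1 reduced_costE lerDl.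
  apply: sumr_ge0 => k _; rewrite mulr_ge0 //.
  by rewrite [X in _ <= X]mxE [X in _ + X]mxE subr_ge0.
rewrite mulmxBl [X in _ <= X]mxE [X in _ <= _ + X]mxE.
by move: zu ubx; lra.
Qed.

End Supports.

Theorem mainTheorem4 (R : realType) (n : nat)
    (D : 'I_n -> {fset int}) (C : set (n.-tuple int))
    (c : vpair D -> int)
    (m : nat) (A : 'M[R]_(m, #|vpair D|)) (b : 'cV[R]_m)
    (ideal : primal_feasible A b = convex_hull (charvecs D C R))
    (feas : feasibility D C)
    (I : {set vpair D})
    (incompI : forall p q, p \in I -> q \in I -> p != q ->
                 incompatible C p q) :
  exists u : 'rV[R]_m,
    [/\ dual_optimal A b (rowB (modified_cost A b c I)) u,
        dual_optimal A b (rowB (costR R c)) u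
      & forall p, p \in I -> reduced_cost A c p u = Rgap A b c p].
Proof.
have [u fu zu] : exists2 u, dual_feasible A (rowB (modified_cost A b c I)) u
    & zstar A b c <= (u *m b) 0 0.
  apply: affine_farkas => [|x].
    have [[a Ca] _] := feas; exists (charvec D R a).
    exact: charvec_feasible ideal _ Ca.
  rewrite {1}ideal; apply: convex_hull_ge => _ [a Ca <-].
  exact: (modified_cost_charvec_ge c ideal incompI Ca).
have weaken v : dual_feasible A (rowB (modified_cost A b c I)) v ->
    dual_feasible A (rowB (costR R c)) v.
  move=> [v0 vA]; split=> // k; apply: le_trans (vA k) _.
  by rewrite !mxE; apply: modified_cost_le ideal feas _ _.
have opt v : dual_feasible A (rowB (costR R c)) v ->
    (v *m b) 0 0 <= (u *m b) 0 0.
  move=> fv; apply: le_trans zu; apply: (le_zstar ideal feas) => x fx.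
  by have /andP[vb vA] := weak_duality fx fv; apply: le_trans vA.
(* The modified dual has the smaller feasible set, so the bound [opt] for the original dual covers
   both. *)
exists u; split; [by split=> // v /weaken/opt | by split=> //; apply: weaken |].
move=> p pI; apply/eqP; rewrite eq_le.
rewrite (reduced_cost_le_Rgap ideal feas _ (weaken _ fu) zu) /=.
have [_ /(_ (enum_rank p))] := fu.
rewrite [rowB _ _ _]mxE enum_rankK /modified_cost pI => uA.
rewrite reduced_costE [X in _ <= X]mxE [X in _ <= X + _]mxE.
rewrite [X in _ <= _ + X]mxE enum_rankK.
by move: uA; lra.
Qed.
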